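(* Let $X$ be a (nonempty) connected compact metric space and let $f:X\to X$ be an expansive homeomorphism. If $X$ is not a single point, then $f$ has a non-recurrent point, i.e. there is $x\in X$ that is not recurrent for $f$.
   Context: Let $f$ be a homeomorphism of a compact metric space $(X,d)$. A point $x\in X$ is positively recurrent if there are $0<n_1<n_2<\cdots$ with $f^{n_i}(x)\to x$; negatively recurrent if there are $0<n_1<n_2<\cdots$ with $f^{-n_i}(x)\to x$; and recurrent if it is either positively recurrent or negatively recurrent. $f$ is expansive if there is $c>0$ such that $\sup_{n\in\mathbb{Z}} d(f^n(x),f^n(y))>c$ for all distinct $x,y\in X$. *)

(* Defs.v *)
From HB Require Import structures.
From mathcomp Require Import all_boot all_order all_algebra.
From mathcomp Require Import all_classical all_reals all_analysis.

Set Implicit Arguments.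
Unset Strict Implicit.
Unset Printing Implicit Defensive.

Import Order.TTheory GRing.Theory Num.Theory.

Local Open Scope classical_set_scope.
Local Open Scope ring_scope.

(* The inverse is a field because the negative iterates refer to it; it is
   determined by the underlying function. *)
Record homeo (T : topologicalType) := Homeo {
  homeo_fun :> T -> T ;
  homeo_inv : T -> T ;
  homeo_funK : cancel homeo_fun homeo_inv ;
  homeo_invK : cancel homeo_inv homeo_fun ;
  homeo_fun_continuous : continuous homeo_fun ;
  homeo_inv_continuous : continuous homeo_inv
}.

(* [Negz m] is the integer [- m.+1]. *)
Definition iterz (T : topologicalType) (f : homeo T) (n : int) : T -> T :=
  match n with
  | Posz m => iter m f
  | Negz m => iter m.+1 (homeo_inv f)
  end.

Definition positively_recurrent (T : topologicalType) (f : homeo T) (x : T) :=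
  exists n_ : nat -> nat,
    [/\ (0 < n_ 0)%N, {homo n_ : i j / (i < j)%N}
      & iterz f (n_ i)%:Z x @[i --> \oo] --> x].

Definition negatively_recurrent (T : topologicalType) (f : homeo T) (x : T) :=
  exists n_ : nat -> nat,
    [/\ (0 < n_ 0)%N, {homo n_ : i j / (i < j)%N}
      & iterz f (- (n_ i)%:Z) x @[i --> \oo] --> x].

Definition recurrent (T : topologicalType) (f : homeo T) (x : T) :=
  positively_recurrent f x \/ negatively_recurrent f x.

(* The supremum is taken in the extended reals, so that it is meaningful even
   when the set of distances is unbounded. *)
Definition expansive (R : realType) (X : metricType R) (f : homeo X) :=
  exists2 c : R, 0 < c &
    forall x y : X, x <> y ->
      (c%:E < ereal_sup [set (mdist (iterz f n x) (iterz f n y))%:E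
                        | n in [set: int]])%E.

(* Main.v *)
Require Import Defs.
From HB Require Import structures.
From mathcomp Require Import all_boot all_order all_algebra.
From mathcomp Require Import all_classical all_reals all_analysis.
From mathcomp Require Import lra.

(** Why an expansive homeomorphism [f] of a nontrivial continuum has a
    non-recurrent point.

    Call a continuum stable when all its forward iterates have diameter at
    most the expansivity constant [eps].  Blowing up small subcontinua of [X]
    around a point and passing to a limit gives a nondegenerate continuum that
    is stable for [f] or for its inverse ([exists_stable_continuum]); by
    symmetry assume it is stable for [T = f], and write [S] for the inverse.

    Expansivity forces a stable continuum to grow under [S], at a uniform
    speed, and a grown continuum contains a stable piece of definite size [s]
    that avoids the ball of radius [s] around any prescribed point [p]
    ([stable_step]).  If [N] is the time needed to grow from size [s], then
    with [G = T^N] and [H = S^N] one can iterate: inside a stable continuum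
    there are points whose backward [H]-orbit avoids the ball for as long as
    one likes ([avoiding_continuum]).

    Suppose that every point is recurrent, hence recurrent for [G] or for [H]
    ([omega_iter]).  Two facts contradict each other.

    First, a stable continuum [C] lies in the [G]-omega-limit set of each of
    its points ([stable_continuum_sub_omega]).  All points of [C] are forward
    asymptotic, so they share one omega-limit set; were [p] in [C] outside this
    closed set, a small piece of [C] around [p] would be outside as well, and it
    would contain a point whose backward orbit eventually avoids a ball around
    [p] that contains this point: it would be recurrent in neither direction.

    Second, Zorn's lemma gives a minimal closed set [Y], invariant under [G]
    and [H], that contains a stable continuum of size [s].  For [p] in [Y], a
    limit of the avoiding continua is a stable continuum [L] in [Y] whose whole
    forward [G]-orbit stays away from [p].  For [y] in [L], the omega-limit set
    of [y] contains [L] by the first fact, so it is all of [Y] by minimality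
    and contains [p], which is absurd ([no_stable_continuum]).

    Both the passage to the limit and the bottom of a chain in Zorn's lemma are
    instances of one compactness statement on connected sets,
    [limit_connected]. *)

Set Implicit Arguments.
Unset Strict Implicit.
Unset Printing Implicit Defensive.

Import Order.TTheory GRing.Theory Num.Theory.
Local Open Scope classical_set_scope.
Local Open Scope ring_scope.

(** * Continua in compact Hausdorff spaces *)

Section Continua.
Variable T : topologicalType.
Hypotheses (T_hausdorff : hausdorff_space T) (T_compact : compact [set: T]).

(** Compactness in the form used below: a filtered intersection of closed sets
    enters an open set only if one of its members does. *)
Lemma compact_directed_sub (U : topologicalType) (I : Type) (D : set I)
    (F : I -> set U) (O : set U) :
  compact [set: U] -> D !=set0 -> (forall i, D i -> closed (F i)) ->
  (forall i j, D i -> D j -> exists2 k, D k & F k `<=` F i `&` F j) ->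
  open O -> \bigcap_(i in D) F i `<=` O -> exists2 i, D i & F i `<=` O.
Proof.
move=> cU D0 clF dirF oO capO; apply: contrapT => noF.
have PF : ProperFilter (filter_from D (fun i => F i `\` O)).
  apply: filter_from_proper.
    apply: filter_from_filter => // i j Di Dj.
    have [k Dk kij] := dirF _ _ Di Dj.
    by exists k => // x [/kij[Fi Fj] nO]; split; split.
  move=> i Di; apply: contrapT => /nonemptyPn; rewrite setD_eq0 => FO.
  by apply: noF; exists i.
have [p [_ clp]] := cU _ PF filterT.
have Op : O p.
  apply: capO => i Di; apply: (clF _ Di) => V Vp.
  have [|x [[Fx _] Vx]] := clp (F i `\` O) V _ Vp; first by exists i.
  by exists x.
have [i Di] := D0.
have [||x [[_ nOx] Ox]] := clp (F i `\` O) O; last by [].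
- by exists i.
- exact: open_nbhs_nbhs.
Qed.

Lemma connected_open_cover (C U V : set T) (q : T) :
  connected C -> open U -> open V -> U `&` V = set0 -> C `<=` U `|` V ->
  C q -> U q -> C `<=` U.
Proof.
move=> cC oU oV UV CUV Cq Uq.
rewrite -[X in X `<=` _](cC (C `&` U)); first by move=> x [].
- by exists q.
- by exists U.
- exists (~` V); first exact: open_closedC.
  apply/seteqP; split=> x [Cx Hx]; split=> //.
    by move=> Vx; have : set0 x by rewrite -UV.
  by case: (CUV _ Cx).
Qed.

(** By normality a disconnection of a closed set can be thickened to disjoint
    open sets of the space, so only these need testing; anchoring the test at a
    point [q] of [C] makes it asymmetric and cheaper to verify. *)
Lemma closed_connected (C : set T) (q : T) : closed C -> C q ->
  (forall U V, open U -> open V -> U `&` V = set0 -> C `<=` U `|` V ->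
    U q -> C `<=` U) ->
  connected C.
Proof.
move=> clC Cq sepC; apply: contrapT => /connectedPn[E [E0 CE sepE]].
wlog Eq : E E0 CE sepE / E false q.
  move=> wl; have : C q by [].
  rewrite {1}CE => -[Eq|Eq]; first exact: (wl E).
  apply: (wl (E \o negb)) => //=.
  - by rewrite setUC CE.
  - by rewrite separatedC.
have clE : closed (E false).
  move=> x Ex; have : C x.
    by apply: clC; apply: closureS Ex; rewrite CE => y; left.
  rewrite CE => -[//|E1]; have [s0 _] := sepE.
  by have : set0 x by rewrite -s0.
have nE : open (~` closure (E true)).
  exact/closed_openC/closed_closure.
have : set_nbhs (E false) (~` closure (E true)).
  apply/set_nbhsP; exists (~` closure (E true)); split=> // x Ex E1.
  by have [_ s0] := sepE; have : set0 x by rewrite -s0.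
move=> /(compact_normal T_hausdorff T_compact clE)[W].
move=> /set_nbhsP[U [oU EU UW]] WE.
have [x Ex] := E0 true.
have Cx : C x by rewrite CE; right.
have CU : C `<=` U.
  apply: (sepC U (~` closure W)) => //.
  - exact/closed_openC/closed_closure.
  - by apply/seteqP; split=> // y [/UW /subset_closure Wy]; apply.
  - rewrite CE => y [/EU|]; [by left|right=> /WE; apply].
    exact: subset_closure.
  - exact: EU.
have /WE : closure W x by apply: subset_closure; apply: UW; apply: CU.
by apply; exact: subset_closure.
Qed.

(** The component of [q] in [C `&` E] reaches the complement of [O].  The set
    [D] is the quasi-component of [q]; if it stayed in [O], some relatively
    clopen subset of [C `&` E] around [q] would stay in [O] too, and hence be
    clopen in [C]. *)
Lemma boundary_bumping (C E O : set T) (q : T) :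
  closed C -> connected C -> closed E -> open O -> O `<=` E -> C q -> E q ->
  ~ (C `<=` O) ->
  exists D : set T, [/\ closed D, connected D, D `<=` C `&` E, D q
    & ~ (D `<=` O)].
Proof.
move=> clC conC clE oO OE Cq Eq nCO.
pose L : set (set T) := [set H |
  [/\ closed H, closed ((C `&` E) `\` H), H `<=` C `&` E & H q]].
have LCE : L (C `&` E).
  by split=> //; [exact: closedI|rewrite setDv; exact: closed0].
have dirL H1 H2 : L H1 -> L H2 -> exists2 H, L H & H `<=` H1 `&` H2.
  move=> [c1 d1 s1 q1] [c2 d2 s2 q2]; exists (H1 `&` H2) => //; split=> //.
  - exact: closedI.
  - by rewrite setDIr; exact: closedU.
  - by move=> x [/s1].
have QL : \bigcap_(H in L) H `<=` C `&` E by move=> x; apply.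
exists (\bigcap_(H in L) H); split=> //.
- by apply: closed_bigI => H [].
- have clQ : closed (\bigcap_(H in L) H) by apply: closed_bigI => H [].
  apply: (@closed_connected _ q) => //; first by move=> H [].
  move=> U V oU oV UV QUV Uq.
  have [H LH HUV] := compact_directed_sub T_compact
    (ex_intro _ _ LCE) (fun H (LH : L H) => let: And4 h _ _ _ := LH in h)
    dirL (openU oU oV) QUV.
  case: (LH) => cH dH sH Hq.
  (* Cutting the clopen set H along the gap between U and V leaves it clopen. *)
  have HU : H `&` U = H `\` V.
    apply/seteqP; split=> x [Hx]; move=> Hy; split=> //.
      by move=> Vx; have : set0 x by rewrite -UV.
    by case: (HUV _ Hx).
  suff LHU : L (H `&` U) by move=> x /(_ _ LHU)[].
  split.
  - by rewrite HU setDE; apply: closedI => //; exact: open_closedC.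
  - rewrite setDIr; apply: closedU => //.
    rewrite setDE; apply: closedI; [exact: closedI|exact: open_closedC].
  - by move=> x [/sH].
  - by [].
- by move=> H [].
- move=> QO.
  have [H LH HO] := compact_directed_sub T_compact
    (ex_intro _ _ LCE) (fun H (LH : L H) => let: And4 h _ _ _ := LH in h)
    dirL oO QO.
  case: (LH) => cH dH sH Hq.
  apply: nCO; suff <- : H = C by [].
  apply: conC; first by exists q.
  + exists (~` (((C `&` E) `\` H) `|` (C `\` O))).
      apply: closed_openC; apply: closedU => //.
      by rewrite setDE; apply: closedI => //; exact: open_closedC.
    apply/seteqP; split=> x.
      move=> Hx; split; first by case: (sH _ Hx).
      by move=> [[_]|[_]]; apply=> //; exact: HO.
    move=> [Cx nx]; apply: contrapT => nHx; apply: nx.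
    have [Ox|nOx] := pselect (O x); last by right.
    by left; split=> //; split=> //; exact: OE.
  + exists H => //; apply/seteqP; split=> x; last by case.
    by move=> Hx; split=> //; case: (sH _ Hx).
Qed.

(** Limits of continua.  Along an ultrafilter of connected sets, the points all
    of whose neighbourhoods are met by most of these sets form a continuum;
    it inherits every closed condition on pairs that is universal (such as [Z])
    or existential with witnesses in a fixed closed set (such as [B], which is
    used to say that the diameter is bounded below).  The directed family [Z]
    covers both sequences and the chains of the maximality argument. *)
Lemma limit_connected (I : Type) (D : set I) (Z : I -> set (T * T))
    (B : set (T * T)) :
  D !=set0 -> (forall i, D i -> closed (Z i)) -> closed B ->
  (forall i j, D i -> D j -> exists2 k, D k & Z k `<=` Z i `&` Z j) ->
  (forall i, D i -> exists C : set T, [/\ connected C,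
     exists2 p, B p & C p.1 /\ C p.2 & forall x y, C x -> C y -> Z i (x, y)]) ->
  exists K : set T, [/\ closed K, connected K,
     exists2 p, B p & K p.1 /\ K p.2 &
     forall i x y, D i -> K x -> K y -> Z i (x, y)].
Proof.
move=> D0 clZ clB dirZ exC.
pose good (C : set T) := connected C /\ exists2 p, B p & C p.1 /\ C p.2.
pose F := filter_from D (fun i =>
  [set C | good C /\ forall x y, C x -> C y -> Z i (x, y)]).
have PF : ProperFilter F.
  apply: filter_from_proper.
    apply: filter_from_filter => // i j Di Dj.
    have [k Dk kij] := dirZ _ _ Di Dj; exists k => // C [gC CZ].
    by split; split=> // x y Cx Cy; case: (kij _ (CZ x y Cx Cy)).
  by move=> i Di; have [C [conC bC CZ]] := exC _ Di; exists C.
have [G [GU FG]] := ultraFilterLemma PF.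
have GZ i : D i -> G [set C | good C /\ forall x y, C x -> C y -> Z i (x, y)].
  by move=> Di; apply: FG; exists i.
have Ggood : G good.
  by have [i Di] := D0; apply: filterS (GZ _ Di) => C [].
have [h hP] : exists h : set T -> T * T,
    forall C, good C -> [/\ B (h C), C (h C).1 & C (h C).2].
  have [i Di] := D0; have [_ [_ [p0 _ _] _]] := exC _ Di.
  suff /choice[h hP] : forall C : set T, exists p : T * T,
    good C -> [/\ B p, C p.1 & C p.2] by exists h.
  move=> C.
  have [[_ [p Bp [C1 C2]]]|nC] := pselect (good C); first by exists p.
  by exists p0.
have cTT : compact [set: T * T].
  by rewrite -setXTT; exact: compact_setX.
(* The coordinates of p are limits of the B-witnesses, hence lie in K. *)
have [p [_ clp]] := cTT (h @ G) _ filterT.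
pose K : set T := [set x : T | forall V, nbhs x V -> G [set C | C `&` V !=set0]].
have Kp1 : K p.1.
  move=> V Vp; have [//|GC] := in_ultra_setVsetC [set C | C `&` V !=set0] GU.
  have hG : G [set C | ~ V (h C).1].
    apply: filterS (filterI GC Ggood) => C [nCV gC] /= Vh; apply: nCV.
    by exists (h C).1; split=> //; have [] := hP _ gC.
  have [|z [/= nV Vz]] := clp [set z | ~ V (fst z)] (fst @^-1` V) hG; last by [].
  by exists (V, setT); [split=> //; exact: filterT|move=> z []].
have Kp2 : K p.2.
  move=> V Vp; have [//|GC] := in_ultra_setVsetC [set C | C `&` V !=set0] GU.
  have hG : G [set C | ~ V (h C).2].
    apply: filterS (filterI GC Ggood) => C [nCV gC] /= Vh; apply: nCV.
    by exists (h C).2; split=> //; have [] := hP _ gC.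
  have [|z [/= nV Vz]] := clp [set z | ~ V (snd z)] (snd @^-1` V) hG; last by [].
  by exists (setT, V); [split=> //; exact: filterT|move=> z []].
have clK : closed K.
  move=> x clx V; rewrite nbhsE => -[W [oW Wx] WV].
  have [y [Ky Wy]] := clx _ (open_nbhs_nbhs (conj oW Wx)).
  apply: filterS (Ky W (open_nbhs_nbhs (conj oW Wy))) => C [z [Cz Wz]].
  by exists z; split=> //; exact: WV.
exists K; split=> //.
- apply: (@closed_connected _ p.1) => // U V oU oV UV KUV Up x Kx.
  apply: contrapT => nUx.
  have Vx : V x by case: (KUV _ Kx).
  have GUV : G [set C | C `<=` U `|` V].
    have cvr (z : T) : [set: T] z ->
        \forall z' \near z & C \near G, C z' -> (U `|` V) z'.
      move=> _; have [Oz|nOz] := pselect ((U `|` V) z).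
        exists (U `|` V, setT); last by move=> [z' C] [/= ? _] _.
        split; last exact: filterT.
        by apply: open_nbhs_nbhs; split=> //; exact: openU.
      have [W Wz nGW] : exists2 W, nbhs z W & ~ G [set C | C `&` W !=set0].
        apply: contrapT => nW; apply: nOz; apply: KUV => W Wz.
        by apply: contrapT => nG; apply: nW; exists W.
      exists (W, [set C | ~ (C `&` W !=set0)]).
        split=> //.
        by have [//|] := in_ultra_setVsetC [set C | C `&` W !=set0] GU.
      by move=> [z' C] [/= Wz' nCW] Cz'; exfalso; apply: nCW; exists z'.
    have /compact_near_coveringP cvT := T_compact.
    have FilG : Filter G by exact: filter_filter.
    have cvU := cvT _ G (fun C z => C z -> (U `|` V) z) FilG cvr.
    by apply: (@filterS _ G) cvU => C CUV z Cz; exact: CUV.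
  have GCU : G [set C | C `&` U !=set0] by apply: Kp1; exact: open_nbhs_nbhs.
  have GCV : G [set C | C `&` V !=set0] by apply: Kx; exact: open_nbhs_nbhs.
  have [C [[gC CUV] [[u [Cu Uu]] [v [Cv Vv]]]]] :=
    filter_ex (filterI (filterI Ggood GUV) (filterI GCU GCV)).
  have Uv := connected_open_cover gC.1 oU oV UV CUV Cu Uu Cv.
  by have : set0 v by rewrite -UV.
- exists p => //; apply: clB => V Vp.
  have hB : G [set C | B (h C)].
    by apply: filterS Ggood => C gC /=; have [] := hP _ gC.
  exact: (clp B V hB Vp).
- move=> i x y Di Kx Ky; apply: (clZ _ Di) => W [[V1 V2] /= [V1x V2y] VW].
  have [C [[[_ CZ] [u [Cu V1u]]] [v [Cv V2v]]]] :=
    filter_ex (filterI (filterI (GZ _ Di) (Kx _ V1x)) (Ky _ V2y)).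
  by exists (u, v); split; [exact: CZ|apply: VW].
Qed.

End Continua.

(** * Distances and iterates *)

Section Metric.
Context {R : realType} {X : metricType R}.
Local Notation d := (@mdist R X).

Lemma near_mdist_lt (Y : topologicalType) (u : Y -> X) (y : Y) (e : R) :
  continuous u -> 0 < e -> \forall z \near y, d (u y) (u z) < e.
Proof.
by move=> cu e0; have := cu y _ (nbhsx_ballx (u y) e e0); rewrite ballEmdist.
Qed.

Lemma open_mdist_lt (Y : topologicalType) (u v : Y -> X) (e : R) :
  continuous u -> continuous v -> open [set y | d (u y) (v y) < e].
Proof.
move=> cu cv; rewrite openE => y /= lt.
have r0 : 0 < (e - d (u y) (v y)) / 2 by lra.
apply: filterS (filterI (near_mdist_lt y cu r0) (near_mdist_lt y cv r0)).
move=> z [/= hu hv].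
have := metric_triangle (u z) (u y) (v z).
have := metric_triangle (u y) (v y) (v z).
rewrite (metric_sym (u z) (u y)); lra.
Qed.

Lemma closed_mdist_le (Y : topologicalType) (u v : Y -> X) (e : R) :
  continuous u -> continuous v -> closed [set y | d (u y) (v y) <= e].
Proof.
move=> cu cv; rewrite -openC openE => y /= /negP; rewrite -ltNge => lt.
have r0 : 0 < (d (u y) (v y) - e) / 2 by lra.
apply: filterS (filterI (near_mdist_lt y cu r0) (near_mdist_lt y cv r0)).
move=> z [/= hu hv]; apply/negP; rewrite -ltNge.
have := metric_triangle (u y) (u z) (v y).
have := metric_triangle (u z) (v z) (v y).
rewrite (metric_sym (v z) (v y)); lra.
Qed.

Lemma closed_mdist_ge (Y : topologicalType) (u v : Y -> X) (e : R) :
  continuous u -> continuous v -> closed [set y | e <= d (u y) (v y)].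
Proof.
move=> cu cv; rewrite -openC; under eq_set => y do rewrite leNgt.
suff -> : ~` [set y | ~~ (d (u y) (v y) < e)] = [set y | d (u y) (v y) < e].
  exact: open_mdist_lt.
by apply/seteqP; split=> y /= => [/negP/negPn|h]; [|apply/negP/negPn].
Qed.

Lemma mdist_split (p x y : X) (t : R) :
  t <= d x y -> t / 2 <= d p x \/ t / 2 <= d p y.
Proof.
move=> txy; have := metric_triangle x p y; rewrite (metric_sym x p) => tri.
by case: (leP (t / 2) (d p x)) => h; [left|right; lra].
Qed.

End Metric.

Lemma closed_forall (Y : topologicalType) (I : Type) (P : I -> set Y) :
  (forall i, closed (P i)) -> closed [set y | forall i, P i y].
Proof. by move=> cP y cy i; apply: (cP i); apply: closureS cy => z /(_ i). Qed.

Lemma open_forall_leq (Y : topologicalType) (n : nat) (P : nat -> set Y) :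
  (forall i, open (P i)) -> open [set y | forall i, (i <= n)%N -> P i y].
Proof.
move=> oP; elim: n => [|n IH].
  rewrite [X in open X](_ : _ = P 0%N)//.
  by apply/seteqP; split=> y; [exact|move=> P0 [|i]].
rewrite [X in open X](_ : _ = P n.+1 `&` [set y | forall i, (i <= n)%N -> P i y]).
  exact: openI.
apply/seteqP; split=> y /=.
  by move=> h; split=> [|i ilen]; apply: h => //; exact: leqW.
by move=> [Pn h] i; rewrite leq_eqVlt => /predU1P[->//|]; exact: h.
Qed.

Lemma iter_continuous (Y : topologicalType) (f : Y -> Y) (n : nat) :
  continuous f -> continuous (iter n f).
Proof.
move=> cf; elim: n => [|n IH] y /=; first by move=> V.
exact: (continuous_comp (IH y) (cf _)).
Qed.

Lemma iter_fst_continuous (Y : topologicalType) (f : Y -> Y) (n : nat) :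
  continuous f -> continuous (fun p : Y * Y => iter n f p.1).
Proof.
by move=> cf p; apply: (@cvg_comp _ _ _ fst (iter n f));
  [exact: cvg_fst|exact: iter_continuous].
Qed.

Lemma iter_snd_continuous (Y : topologicalType) (f : Y -> Y) (n : nat) :
  continuous f -> continuous (fun p : Y * Y => iter n f p.2).
Proof.
by move=> cf p; apply: (@cvg_comp _ _ _ snd (iter n f));
  [exact: cvg_snd|exact: iter_continuous].
Qed.

Section Iterates.
Variables (Y : Type) (T S : Y -> Y).
Hypothesis TK : cancel T S.

Lemma iter_cancel n : cancel (iter n T) (iter n S).
Proof. by elim: n => [//|n IH] x; rewrite iterSr iterS TK IH. Qed.

Lemma iter_cancel_leq j n x : (j <= n)%N ->
  iter j S (iter n T x) = iter (n - j) T x.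
Proof. by move=> jn; rewrite -{1}(subnKC jn) iterD iter_cancel. Qed.

Lemma iter_cancel_geq j n x : (n <= j)%N ->
  iter j S (iter n T x) = iter (j - n) S x.
Proof. by move=> nj; rewrite -{1}(subnK nj) iterD iter_cancel. Qed.

End Iterates.

(** * Omega-limit sets *)

Section OmegaLimit.
Variables (Y : topologicalType).
Implicit Types T : Y -> Y.

(** The omega-limit set, stated without convergent subsequences. *)
Definition omega T (x : Y) : set Y :=
  [set p | forall V, nbhs p V -> forall N, exists2 n, (N <= n)%N & V (iter n T x)].

Lemma omega_closed T x : closed (omega T x).
Proof.
move=> p cp V; rewrite nbhsE => -[W [oW Wp] WV] N.
have [q [oq Wq]] := cp _ (open_nbhs_nbhs (conj oW Wp)).
have [n Nn Wn] := oq W (open_nbhs_nbhs (conj oW Wq)) N.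
by exists n => //; exact: WV.
Qed.

Lemma omega_image T x p : continuous T -> omega T x p -> omega T x (T p).
Proof.
move=> cT op V Vp N; have [n Nn Vn] := op _ (cT _ _ Vp) N.
by exists n.+1 => //; exact: leqW.
Qed.

Lemma omega_preimage T S x p : cancel T S -> continuous S ->
  omega T x p -> omega T x (S p).
Proof.
move=> TK cS op V Vp N; have [[//|n] Nn Vn] := op _ (cS _ _ Vp) N.+1.
by exists n => //; move: Vn; rewrite /= TK.
Qed.

Lemma omega_sub_closed T x p (A : set Y) : closed A ->
  (forall n, A (iter n T x)) -> omega T x p -> A p.
Proof.
move=> cA AT op; apply: cA => V Vp; have [n _ Vn] := op V Vp 0%N.
by exists (iter n T x).
Qed.

Lemma omega_trans T x y z : continuous T ->
  omega T x y -> omega T y z -> omega T x z.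
Proof.
move=> cT oxy; apply: omega_sub_closed; first exact: omega_closed.
by elim=> [//|n IH]; exact: omega_image.
Qed.

(** The times visiting a neighbourhood of [p] fall into [N] residue classes;
    if each class failed for some neighbourhood and some bound, the finite
    intersection and the maximum would fail for all times at once. *)
Lemma omega_iter_cases T x p N : (0 < N)%N -> omega T x p ->
  exists2 i, (i < N)%N & omega (iter N T) (iter i T x) p.
Proof.
move=> N0 op; apply: contrapT => no.
have avoid i : (i < N)%N -> exists VM : set Y * nat, nbhs p VM.1 /\
    forall n, (VM.2 <= n)%N -> ~ VM.1 (iter n (iter N T) (iter i T x)).
  move=> iN; apply: contrapT => nV; apply: no; exists i => // V Vp M.
  apply: contrapT => nn; apply: nV; exists (V, M); split=> // n Mn /= Vn.
  by apply: nn; exists n.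
have uniform_avoid m : (m <= N)%N -> exists VM : set Y * nat, nbhs p VM.1 /\
    forall i n, (i < m)%N -> (VM.2 <= n)%N ->
      ~ VM.1 (iter n (iter N T) (iter i T x)).
  elim: m => [_|m IH mN]; first by exists (setT, 0%N); split=> //; exact: filterT.
  have [[V M] /= [Vp VM]] := IH (ltnW mN).
  have [[W M'] /= [Wp WM]] := avoid m mN.
  exists (V `&` W, maxn M M'); split=> /=; first exact: filterI.
  move=> i n; rewrite ltnS leq_eqVlt geq_max => im /andP[Mn M'n] [Vn Wn].
  case/predU1P: im => [im|im]; last exact: VM Vn.
  by rewrite im in Wn; exact: WM Wn.
have [[V M] /= [Vp VM]] := uniform_avoid N (leqnn N).
have [n Mn Vn] := op V Vp (M * N)%N.
apply: (VM (n %% N)%N (n %/ N)%N).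
- by rewrite ltn_mod.
- by rewrite leq_divRL.
- by rewrite -iterM -iterD -divn_eq.
Qed.

(** A recurrent point is recurrent for every power: for some [i], the point [x]
    is an [iter N T]-limit of [iter i T x], so applying this [N] times it is a
    limit of [iter (N * i) T x], which lies on the [iter N T]-orbit of [x]. *)
Lemma omega_iter T x N : continuous T -> (0 < N)%N ->
  omega T x x -> omega (iter N T) x x.
Proof.
move=> cT N0 oxx; have [i _ oi] := omega_iter_cases N0 oxx.
have cN : continuous (iter N T) by exact: iter_continuous.
have shift k y z : omega (iter N T) y z ->
    omega (iter N T) (iter k T y) (iter k T z).
  move=> oyz V Vz M; have [n Mn Vn] := oyz _ (iter_continuous (n := k) cT Vz) M.
  by exists n => //; move: Vn; rewrite /= -!iterM -!iterD addnC.
have oki k : omega (iter N T) (iter (k.+1 * i) T x) x.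
  elim: k => [|k IH]; first by rewrite mul1n.
  by apply: omega_trans IH => //; rewrite mulSnr iterD; exact: shift.
case: N N0 oi cN shift oki => // N _ _ cN _ /(_ N) oN V Vx M.
have [n Mn Vn] := oN V Vx M; exists (n + i)%N.
  by rewrite (leq_trans Mn)// leq_addr.
by rewrite iterD -[iter i _ x]iterM mulnC.
Qed.

End OmegaLimit.

(** * Stable continua of an expansive homeomorphism *)

Section StableDefs.
Variables (R : realType) (X : metricType R) (T : X -> X) (eps : R).

Definition forward_close (x y : X) :=
  forall n, mdist (iter n T x) (iter n T y) <= eps.

(** The parameter [s] is a lower bound for the diameter, attained by a pair so
    that it passes to limits. *)
Definition stable_continuum (s : R) (C : set X) :=
  [/\ closed C, connected C,
    exists2 p, s <= mdist p.1 p.2 & C p.1 /\ C p.2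
    & forall x y, C x -> C y -> forward_close x y].

Lemma closed_forward_close : continuous T ->
  closed [set p | forward_close p.1 p.2].
Proof.
move=> cT; apply: closed_forall => n.
by apply: closed_mdist_le; [exact: iter_fst_continuous|exact: iter_snd_continuous].
Qed.

End StableDefs.

Section Expansive.
Variables (R : realType) (X : metricType R) (T S : X -> X) (eps : R).
Hypotheses (X_compact : compact [set: X]) (TK : cancel T S) (SK : cancel S T)
  (T_cont : continuous T) (S_cont : continuous S) (eps0 : 0 < eps)
  (exp_TS : forall x y, forward_close T eps x y -> forward_close S eps x y ->
     x = y).
Local Notation d := (@mdist R X).

Let compact_XX : compact [set: X * X].
Proof. by rewrite -setXTT; exact: compact_setX. Qed.

Let cT1 n := iter_fst_continuous (n := n) T_cont.
Let cT2 n := iter_snd_continuous (n := n) T_cont.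
Let cS1 n := iter_fst_continuous (n := n) S_cont.
Let cS2 n := iter_snd_continuous (n := n) S_cont.

(** Expansivity at finitely many times, by compactness of the set of pairs. *)
Lemma uniform_expansivity eta : 0 < eta -> exists M, forall x y,
  (forall n, (n <= M)%N -> d (iter n T x) (iter n T y) <= eps /\
     d (iter n S x) (iter n S y) <= eps) -> d x y < eta.
Proof.
move=> eta0.
pose F M := [set p : X * X | forall n, (n <= M)%N ->
  d (iter n T p.1) (iter n T p.2) <= eps /\
  d (iter n S p.1) (iter n S p.2) <= eps].
have [|||||M _ FM] := @compact_directed_sub _ nat setT F
    [set p | d p.1 p.2 < eta] compact_XX.
- by exists 0%N.
- move=> M _; apply: closed_forall => n; apply: closed_forall => _.
  by apply: closedI; apply: closed_mdist_le.
- move=> i j _ _; exists (maxn i j) => // p Fp.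
  by split=> n nij; apply: Fp; rewrite leq_max nij ?orbT.
- by apply: open_mdist_lt; [move=> p; exact: cvg_fst|move=> p; exact: cvg_snd].
- move=> p Fp /=; rewrite (@exp_TS p.1 p.2) ?mdistxx//.
    by move=> n; have [] := Fp n I n (leqnn n).
  by move=> n; have [] := Fp n I n (leqnn n).
- by exists M => x y; exact: (FM (x, y)).
Qed.

(** Forward close pairs are asymptotic, uniformly: at a late time the orbits
    have been close for long in both directions. *)
Lemma forward_close_uniform eta : 0 < eta -> exists M, forall x y,
  forward_close T eps x y -> forall n, (M <= n)%N ->
  d (iter n T x) (iter n T y) < eta.
Proof.
move=> eta0; have [M UM] := uniform_expansivity eta0.
exists M => x y xy n Mn; apply: UM => j jM; split.
  by rewrite -!iterD; exact: xy.
by rewrite !(iter_cancel_leq TK) ?(leq_trans jM)//; exact: xy.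
Qed.

(** Forward close pairs cannot be expanded: late times are handled by
    [forward_close_uniform] and the finitely many early ones by continuity.
    The contrapositive bounds the size of a stable set from below by the size
    of any one of its forward iterates. *)
Lemma forward_close_small eta : 0 < eta -> exists2 e, 0 < e & forall x y,
  forward_close T eps x y -> d x y < e ->
  forall n, d (iter n T x) (iter n T y) < eta.
Proof.
move=> eta0; have [M UM] := forward_close_uniform eta0.
pose F (e : R) := [set p : X * X | d p.1 p.2 <= e].
have [|||||e /= e0 Fe] := @compact_directed_sub _ R [set e | 0 < e] F
    [set p | forall n, (n <= M)%N -> d (iter n T p.1) (iter n T p.2) < eta]
    compact_XX.
- by exists 1 => /=.
- by move=> e _; apply: closed_mdist_le;
    [move=> p; exact: cvg_fst|move=> p; exact: cvg_snd].
- move=> i j /= i0 j0; exists (Num.min i j); first by rewrite lt_min i0.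
  by move=> p; rewrite /F /= le_min => /andP[].
- by apply: open_forall_leq => n; exact: open_mdist_lt.
- move=> p Fp n _; suff -> : p.1 = p.2 by rewrite mdistxx.
  apply: mdist_positivity; apply/eqP; rewrite eq_le mdist_ge0 andbT.
  by apply/ler_addgt0Pl => e e0; rewrite addr0; exact: Fp.
- exists e => // x y xy dxy n; have [Mn|nM] := leqP M n; first exact: UM.
  by apply: (Fe (x, y)) (ltnW nM); exact: ltW.
Qed.

Lemma stable_subcontinuum t C p r : 0 < t -> stable_continuum T eps t C ->
  C p -> 0 < r -> exists2 s, 0 < s & exists D, [/\ stable_continuum T eps s D,
    D `<=` C & forall z, D z -> d p z <= r].
Proof.
move=> t0 [clC conC [[x y] /= xy [Cx Cy]] stC] Cp r0.
pose a := Num.min r (t / 2).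
have a0 : 0 < a by rewrite lt_min r0 /=; lra.
have [||||||||D [clD conD DCE Dp nDO]] := @boundary_bumping X
    (@metric_hausdorff _ X) X_compact C [set z | d p z <= a]
    [set z | d p z < a] p.
- exact: clC.
- exact: conC.
- by apply: closed_mdist_le => z; [exact: cvg_cst|exact: cvg_id].
- by apply: open_mdist_lt => z; [exact: cvg_cst|exact: cvg_id].
- by move=> z; exact: ltW.
- exact: Cp.
- by rewrite /= mdistxx ltW.
- move=> CO; have := CO _ Cx; have := CO _ Cy => /=; rewrite !lt_min.
  by move=> /andP[_ py] /andP[_ px]; case: (mdist_split p xy) => ?; lra.
have [z Dz /negP] : exists2 z, D z & ~ (d p z < a).
  apply: contrapT => nz; apply: nDO => z Dz; apply: contrapT => nO.
  by apply: nz; exists z.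
rewrite -leNgt => az.
exists a => //; exists D; split.
- split=> //; first by exists (p, z).
  by move=> u v /DCE[Cu _] /DCE[Cv _]; exact: stC.
- by move=> u /DCE[].
- by move=> u /DCE[_ /= /le_trans]; apply; rewrite ge_min lexx.
Qed.

(** The engine of the proof.  The preimage of [C] under [iter n T] is large at
    some time between [0] and [n] by expansivity, so bumping in the distance
    taken over these times yields a stable subcontinuum which is large at one of
    these times, hence has diameter at least [e] by [forward_close_small]; the
    point of this last step is that [e] depends neither on [t] nor on [n].  One
    of two points at distance [e] is far from [p], and a piece of size [e / 4]
    around it misses the ball of radius [e / 4] around [p]. *)
Lemma stable_step : exists2 s, 0 < s & forall t, 0 < t -> exists M,
  forall n p C, (M <= n)%N -> stable_continuum T eps t C ->
  exists D, [/\ stable_continuum T eps s D, forall z, D z -> C (iter n T z)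
    & forall z, D z -> s <= d p z].
Proof.
have eps2 : 0 < eps / 2 by rewrite divr_gt0.
have [e e0 He] := forward_close_small eps2.
exists (e / 4); first by lra.
move=> t t0; have [M UM] := uniform_expansivity t0; exists M.
move=> n p C Mn [clC conC [[x y] /= xy [Cx Cy]] stC].
have Sn z : iter n T (iter n S z) = z by exact: iter_cancel.
have clP : closed (iter n T @^-1` C).
  by apply: preimage_closed => // z _; exact: iter_continuous.
have conP : connected (iter n T @^-1` C).
  suff -> : iter n T @^-1` C = iter n S @` C.
    apply: connected_continuous_connected => //.
    exact/continuous_subspaceT/iter_continuous.
  apply/seteqP; split=> z; last by move=> [w Cw <-]; rewrite /= Sn.
  by move=> Cz; exists (iter n T z) => //; exact: iter_cancel.
pose q := iter n S x.
have [||||||||D [clD conD DCE Dq nDO]] := @boundary_bumping X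
    (@metric_hausdorff _ X) X_compact (iter n T @^-1` C)
    [set z | forall j, (j <= n)%N -> d (iter j T q) (iter j T z) <= eps / 2]
    [set z | forall j, (j <= n)%N -> d (iter j T q) (iter j T z) < eps / 2] q.
- exact: clP.
- exact: conP.
- apply: closed_forall => j; apply: closed_forall => _.
  by apply: closed_mdist_le => z; [exact: cvg_cst|exact: iter_continuous].
- apply: open_forall_leq => j.
  by apply: open_mdist_lt => z; [exact: cvg_cst|exact: iter_continuous].
- by move=> z h j /h /ltW.
- by rewrite /= Sn.
- by move=> j _; rewrite mdistxx ltW.
- move=> /(_ (iter n S y)) /=; rewrite Sn => /(_ Cy) hO.
  suff : d x y < t by rewrite ltNge xy.
  apply: UM => j jM; split; first exact: stC.
  have jn := leq_trans jM Mn.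
  have := hO (n - j)%N (leq_subr _ _).
  by rewrite !(iter_cancel_leq SK) ?leq_subr// subKn//; lra.
have stD u v : D u -> D v -> forward_close T eps u v.
  move=> /DCE[/= Cu Eu] /DCE[/= Cv Ev] j.
  have [jn|nj] := leqP j n.
    have := metric_triangle (iter j T u) (iter j T q) (iter j T v).
    have := Eu _ jn; have := Ev _ jn.
    by rewrite (metric_sym (iter j T u) (iter j T q)); lra.
  by rewrite -(subnK (ltnW nj)) !iterD; exact: stC.
have [z Dz eqz] : exists2 z, D z & e <= d q z.
  apply: contrapT => nz; apply: nDO => z Dz j _; apply: He; first exact: stD.
  by rewrite ltNge; apply/negP => ez; apply: nz; exists z.
have [w [w' [Dw Dw' pw ww']]] :
    exists w w', [/\ D w, D w', e / 2 <= d p w & e <= d w w'].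
  case: (mdist_split p eqz) => h; first by exists q, z.
  by exists z, q; split=> //; rewrite metric_sym.
have [||||||||K [clK conK KDE Kw nKO]] := @boundary_bumping X
    (@metric_hausdorff _ X) X_compact D [set z | d w z <= e / 4]
    [set z | d w z < e / 4] w.
- exact: clD.
- exact: conD.
- by apply: closed_mdist_le => u; [exact: cvg_cst|exact: cvg_id].
- by apply: open_mdist_lt => u; [exact: cvg_cst|exact: cvg_id].
- by move=> u; exact: ltW.
- exact: Dw.
- by rewrite /= mdistxx ltW//; lra.
- by move=> /(_ w' Dw') /=; lra.
have [u Ku /negP] : exists2 u, K u & ~ (d w u < e / 4).
  apply: contrapT => nz; apply: nKO => u Ku; apply: contrapT => nO.
  by apply: nz; exists u.
rewrite -leNgt => au.
exists K; split.
- split=> //; first by exists (w, u).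
  by move=> a b /KDE[Da _] /KDE[Db _]; exact: stD.
- by move=> a /KDE[/DCE[]].
- move=> a /KDE[_ /= wa]; have := metric_triangle p a w.
  by rewrite (metric_sym a w); lra.
Qed.

End Expansive.

Lemma forall_or_of_anti (P Q : nat -> Prop) :
  (forall i j, (i <= j)%N -> P j -> P i) ->
  (forall i j, (i <= j)%N -> Q j -> Q i) ->
  (forall i, P i \/ Q i) -> (forall i, P i) \/ (forall i, Q i).
Proof.
move=> aP aQ PQ; apply: contrapT => /not_orP[/existsNP[i nPi] /existsNP[j nQj]].
case: (PQ (maxn i j)) => [/aP|/aQ] h.
  by apply: nPi; apply: h; rewrite leq_maxl.
by apply: nQj; apply: h; rewrite leq_maxr.
Qed.

Section Limit.
Variables (R : realType) (X : metricType R).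
Hypothesis X_compact : compact [set: X].

Lemma limit_stable_continuum (I : Type) (D : set I) (Z : I -> set X)
    (T : X -> X) (eps s : R) :
  continuous T -> D !=set0 -> (forall i, D i -> closed (Z i)) ->
  (forall i j, D i -> D j -> exists2 k, D k & Z k `<=` Z i `&` Z j) ->
  (forall i, D i -> exists2 C, stable_continuum T eps s C & C `<=` Z i) ->
  exists2 K, stable_continuum T eps s K & forall i, D i -> K `<=` Z i.
Proof.
move=> cT D0 clZ dirZ exC.
have [|||||K [clK conK bK KZ]] := @limit_connected X
  (@metric_hausdorff _ X) X_compact I D
  (fun i => [set p | forward_close T eps p.1 p.2 /\ Z i p.1])
  [set p | s <= mdist p.1 p.2].
- by [].
- move=> i Di; apply: closedI; first exact: closed_forward_close.
  by apply: preimage_closed (clZ _ Di) => p _; exact: cvg_fst.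
- by apply: closed_mdist_ge => p; [exact: cvg_fst|exact: cvg_snd].
- move=> i j Di Dj; have [k Dk kij] := dirZ _ _ Di Dj; exists k => //.
  by move=> p [fp /kij[Zi Zj]].
- move=> i Di; have [C [_ conC bC stC] CZ] := exC _ Di.
  by exists C; split=> // x y Cx Cy; split; [exact: stC|exact: CZ].
exists K; last by move=> i Di x Kx; have [] := KZ _ _ _ Di Kx Kx.
split=> // x y Kx Ky; have [i Di] := D0.
by have [] := KZ _ _ _ Di Kx Ky.
Qed.

Lemma stable_continuum_of_finite_times (T : X -> X) (eps s : R) :
  continuous T ->
  (forall i, exists C : set X, [/\ connected C,
     exists2 p, s <= mdist p.1 p.2 & C p.1 /\ C p.2 &
     forall n x y, (n <= i)%N -> C x -> C y ->
       mdist (iter n T x) (iter n T y) <= eps]) ->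
  exists K, stable_continuum T eps s K.
Proof.
move=> cT exC.
have [|||||K [clK conK bK KZ]] := @limit_connected X
  (@metric_hausdorff _ X) X_compact nat setT
  (fun i => [set p | forall n, (n <= i)%N ->
     mdist (iter n T p.1) (iter n T p.2) <= eps])
  [set p | s <= mdist p.1 p.2].
- by exists 0%N.
- move=> i _; apply: closed_forall => n; apply: closed_forall => _.
  by apply: closed_mdist_le; [exact: iter_fst_continuous|exact: iter_snd_continuous].
- by apply: closed_mdist_ge => p; [exact: cvg_fst|exact: cvg_snd].
- move=> i j _ _; exists (maxn i j) => // p hp.
  by split=> n nij; apply: hp; rewrite leq_max nij ?orbT.
- move=> i _; have [C [conC bC stC]] := exC i.
  by exists C; split=> // x y Cx Cy n ni; exact: stC.
by exists K; split=> // x y Kx Ky n; exact: (KZ n x y I Kx Ky n (leqnn n)).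
Qed.

End Limit.

(** * Recurrence excludes stable continua *)

Section Expansive.
Variables (R : realType) (X : metricType R) (T S : X -> X) (eps : R).
Hypotheses (X_compact : compact [set: X]) (TK : cancel T S) (SK : cancel S T)
  (T_cont : continuous T) (S_cont : continuous S) (eps0 : 0 < eps)
  (exp_TS : forall x y, forward_close T eps x y -> forward_close S eps x y ->
     x = y).
Local Notation d := (@mdist R X).

(** Bump around [x] in the distance over all times between [-k] and [k]: the
    resulting continuum [D] attains size [eps / 2] at some time [j] or [-j].
    In the first case the orbits of the points of [iter j T @` D] stay close
    for at least [k] steps under [S], in the second case those of
    [iter j S @` D] do so under [T].  One of the cases occurs for arbitrarily
    large [k], and a limit of these images is stable for [S] or for [T]. *)
Lemma exists_stable_continuum (x y : X) : connected [set: X] -> x <> y ->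
  exists2 s, 0 < s & (exists C, stable_continuum T eps s C) \/
                     (exists C, stable_continuum S eps s C).
Proof.
move=> conX xy; have eps2 : 0 < eps / 2 by rewrite divr_gt0.
exists (eps / 2) => //.
have [n0 far] : exists n, ~ (d (iter n T x) (iter n T y) <= eps /\
    d (iter n S x) (iter n S y) <= eps).
  apply/existsNP => close; apply: xy; apply: exp_TS => n.
    by have [] := close n.
  by have [] := close n.
pose witness (f : X -> X) i := exists C : set X, [/\ connected C,
  exists2 p, eps / 2 <= d p.1 p.2 & C p.1 /\ C p.2 &
  forall n u v, (n <= i)%N -> C u -> C v -> d (iter n f u) (iter n f v) <= eps].
have anti f i j : (i <= j)%N -> witness f j -> witness f i.
  move=> ij [C [conC bC CC]]; exists C; split=> // n u v ni.
  by apply: CC; exact: leq_trans ij.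
suff /(forall_or_of_anti (anti S) (anti T)) : forall i, witness S i \/ witness T i.
  case=> [wS|wT]; [right|left]; exact: stable_continuum_of_finite_times.
move=> i; pose k := maxn n0 i.
have ik : (i <= k)%N by rewrite leq_maxr.
have [||||||||D [clD conD DCE Dx nDO]] := @boundary_bumping X
    (@metric_hausdorff _ X) X_compact setT
    [set z | forall j, (j <= k)%N -> d (iter j T x) (iter j T z) <= eps / 2 /\
       d (iter j S x) (iter j S z) <= eps / 2]
    [set z | forall j, (j <= k)%N -> d (iter j T x) (iter j T z) < eps / 2 /\
       d (iter j S x) (iter j S z) < eps / 2] x.
- exact: closedT.
- exact: conX.
- apply: closed_forall => j; apply: closed_forall => _; apply: closedI;
    by apply: closed_mdist_le => z; [exact: cvg_cst|exact: iter_continuous].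
- apply: open_forall_leq => j; apply: openI;
    by apply: open_mdist_lt => z; [exact: cvg_cst|exact: iter_continuous].
- by move=> z h j /h[? ?]; split; exact: ltW.
- by [].
- by move=> j _; rewrite !mdistxx; split; exact: ltW.
- move=> /(_ y I n0); rewrite leq_maxl => /(_ isT)[h1 h2]; apply: far.
  by split; lra.
have closeT u v j : D u -> D v -> (j <= k)%N -> d (iter j T u) (iter j T v) <= eps.
  move=> /DCE[_ Eu] /DCE[_ Ev] jk; have [hu _] := Eu _ jk; have [hv _] := Ev _ jk.
  have := metric_triangle (iter j T u) (iter j T x) (iter j T v).
  by rewrite (metric_sym (iter j T u) (iter j T x)); lra.
have closeS u v j : D u -> D v -> (j <= k)%N -> d (iter j S u) (iter j S v) <= eps.
  move=> /DCE[_ Eu] /DCE[_ Ev] jk; have [_ hu] := Eu _ jk; have [_ hv] := Ev _ jk.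
  have := metric_triangle (iter j S u) (iter j S x) (iter j S v).
  by rewrite (metric_sym (iter j S u) (iter j S x)); lra.
have conI (f : X -> X) j : continuous f -> connected (iter j f @` D).
  move=> cf; apply: connected_continuous_connected => //.
  exact/continuous_subspaceT/iter_continuous.
have [z [j [Dz jk zj]]] : exists z j, [/\ D z, (j <= k)%N &
    eps / 2 <= d (iter j T x) (iter j T z) \/
    eps / 2 <= d (iter j S x) (iter j S z)].
  apply: contrapT => nz; apply: nDO => z Dz j jk; apply: contrapT => nO.
  apply: nz; exists z, j; split=> //; rewrite 2!leNgt.
  by apply/orP; rewrite -negb_and; apply/negP => /andP.
(* Going back n <= k steps from time j leads to times between j - k and j,
   all of which lie in the window where D is controlled. *)
case: zj => zj; [left|right].
  exists (iter j T @` D); split; first exact: conI.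
    by exists (iter j T x, iter j T z) => //; split; [exists x|exists z].
  move=> n _ _ ni [u Du <-] [v Dv <-]; have [nj|/ltnW jn] := leqP n j.
    rewrite !(iter_cancel_leq TK)//; apply: closeT => //.
    by rewrite (leq_trans (leq_subr _ _)).
  rewrite !(iter_cancel_geq TK)//; apply: closeS => //.
  by rewrite (leq_trans (leq_subr _ _))// (leq_trans ni).
exists (iter j S @` D); split; first exact: conI.
  by exists (iter j S x, iter j S z) => //; split; [exists x|exists z].
move=> n _ _ ni [u Du <-] [v Dv <-]; have [nj|/ltnW jn] := leqP n j.
  rewrite !(iter_cancel_leq SK)//; apply: closeS => //.
  by rewrite (leq_trans (leq_subr _ _)).
rewrite !(iter_cancel_geq SK)//; apply: closeT => //.
by rewrite (leq_trans (leq_subr _ _))// (leq_trans ni).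
Qed.

(** Forward close points are asymptotic, so they have the same limit points. *)
Lemma omega_forward_close N x y p : (0 < N)%N -> forward_close T eps x y ->
  omega (iter N T) x p -> omega (iter N T) y p.
Proof.
move=> N0 xy op V Vp K.
have [e /= e0 eV] : exists2 e : R, 0 < e & [set z | d p z < e] `<=` V.
  move: Vp; rewrite -(metricType_numDomainType.filter_from_mdist_nbhs p).
  by move=> [e e0 eV]; exists e.
have e2 : 0 < e / 2 by rewrite divr_gt0.
have [M UM] := forward_close_uniform X_compact TK T_cont S_cont exp_TS e2.
have [|n Kn /= hn] := op [set z | d p z < e / 2] _ (maxn K M).
- by apply/metricType_numDomainType.nbhs_mdistP; exists (e / 2).
- exists n; first by move: Kn; rewrite geq_max => /andP[].
  apply: eV => /=.
  have Mn : (M <= n * N)%N.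
    move: Kn; rewrite geq_max => /andP[_ /leq_trans]; apply.
    by rewrite leq_pmulr.
  have := UM _ _ xy _ Mn; rewrite !iterM.
  have := metric_triangle p (iter n (iter N T) x) (iter n (iter N T) y).
  lra.
Qed.

(** The scale [s] comes from [stable_step]; [N] is a growth time for size [s]
    itself, so that each application of [iter N S] can be followed by a choice
    of a piece of the same size, and the choice can be repeated for ever. *)
Section Power.
Variables (N : nat) (s : R).
Hypotheses (N0 : (0 < N)%N) (s0 : 0 < s)
  (step_N : forall p C, stable_continuum T eps s C ->
    exists D, [/\ stable_continuum T eps s D, forall z, D z -> C (iter N T z)
      & forall z, D z -> s <= d p z])
  (step : forall t, 0 < t -> exists M,
    forall n p C, (M <= n)%N -> stable_continuum T eps t C ->
    exists D, [/\ stable_continuum T eps s D, forall z, D z -> C (iter n T z)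
      & forall z, D z -> s <= d p z]).

Local Notation G := (iter N T).
Local Notation H := (iter N S).

(** A point [z] of [D] reaches [C] at time [k], so seen from [C] it is the end of
    a backward orbit of length [k] that avoids the ball around [p]. *)
Lemma avoiding_continuum p C k : stable_continuum T eps s C ->
  exists D, [/\ stable_continuum T eps s D, forall z, D z -> C (iter k G z)
    & forall i z, (i < k)%N -> D z -> s <= d p (iter i G z)].
Proof.
move=> stC; elim: k => [|k [D [stD DC Dp]]]; first by exists C.
have [D' [stD' D'D D'p]] := step_N p stD.
exists D'; split=> // [z Dz|[|i] z ik Dz].
- by rewrite iterSr; apply: DC; exact: D'D.
- exact: D'p.
- by rewrite iterSr; apply: Dp => //; exact: D'D.
Qed.

Hypothesis rec : forall x, omega T x x \/ omega S x x.

(** If [p] is not in the omega-limit set of [x], nor are the points near [p].  The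
    piece [D] of [C] close to [p] contains, by compactness, a point [y] whose
    backward orbit avoids the ball of radius [s] around [p] from some time on;
    as [y] is in this ball, it is not recurrent for [H], and it is not recurrent
    for [G] since its omega-limit set is that of [x]. *)
Lemma stable_continuum_sub_omega t C x p : 0 < t ->
  stable_continuum T eps t C -> C x -> C p -> omega G x p.
Proof.
move=> t0 stC Cx Cp; apply: contrapT => nop.
have [r /= r0 hr] : exists2 r : R, 0 < r & [set z | d p z < r] `<=` ~` omega G x.
  have : nbhs p (~` omega G x).
    apply: open_nbhs_nbhs; split=> //.
    exact/closed_openC/omega_closed.
  rewrite -(metricType_numDomainType.filter_from_mdist_nbhs p).
  by move=> [r r0 hr]; exists r.
have m0 : 0 < Num.min r s by rewrite lt_min r0.
pose r' := Num.min r s / 2.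
have r'0 : 0 < r' by rewrite divr_gt0.
have /andP[r'r r's] : (r' < r) && (r' < s).
  by rewrite -lt_min ltr_pdivrMr// mulr_natr mulr2n ltrDl.
have [t' t'0 [D [stD DC Dr]]] :=
  stable_subcontinuum X_compact t0 stC Cp r'0.
have [M stepM] := step t'0.
(* The growth time must be a multiple of N, for the orbits are those of H. *)
have MNM : (M <= M * N)%N by rewrite leq_pmulr.
have [D1 [stD1 D1D _]] := stepM _ p _ MNM stD.
have clD : closed D by case: stD.
have H_cont j : continuous (iter j H).
  by apply: iter_continuous; exact: iter_continuous.
have GK : cancel G H by exact: iter_cancel.
pose F k := D `&` [set y | forall j, (0 < j <= k)%N -> s <= d p (iter (M + j) H y)].
have [y Fy] : exists y, forall k, F k y.
  apply: contrapT => nF.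
  have [|||||k _] := @compact_directed_sub X nat setT F set0 X_compact.
  - by exists 0%N.
  - move=> k _; apply: closedI => //; apply: closed_forall => j.
    apply: closed_forall => _; apply: closed_mdist_ge => z; first exact: cvg_cst.
    exact: H_cont.
  - move=> i j _ _; exists (maxn i j) => // z [Dz hz].
    split; split=> // n /andP[n0 nij]; apply: hz;
      by rewrite n0 leq_max nij ?orbT.
  - exact: open0.
  - by move=> y Fy; apply: nF; exists y => k; exact: Fy.
  - have [D2 [[_ _ [[z _] _ [/= D2z _]] _] D2D1 D2p]] := avoiding_continuum p k stD1.
    move=> /(_ (iter (M + k) G z)); apply; split.
      rewrite iterD -(iterM M N T).
      by apply: D1D; exact: D2D1.
    move=> j /andP[j0 jk] /=.
    rewrite (iter_cancel_leq GK) ?leq_add2l// subnDl.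
    by apply: D2p => //; rewrite ltn_subrL j0 (leq_trans j0).
have Dy : D y by have [] := Fy 0%N.
have py : d p y < s by exact: le_lt_trans (Dr _ Dy) r's.
have nHy : ~ omega H y y.
  move=> oy; have [|n Mn /= hn] := oy [set z | d p z < s] _ M.+1; last first.
  - have [_ /(_ (n - M)%N)] := Fy (n - M)%N.
    rewrite subn_gt0 Mn leqnn subnKC ?(ltnW Mn)// => /(_ isT).
    by rewrite leNgt hn.
  - apply: open_nbhs_nbhs; split=> //.
    by apply: open_mdist_lt => z; [exact: cvg_cst|exact: cvg_id].
have Gy : omega G y y.
  by case: (rec y) => [|/(omega_iter S_cont N0)//]; exact: omega_iter.
have stxy : forward_close T eps y x.
  by case: stC => _ _ _; apply=> //; exact: DC.
apply: (hr y) => /=; first exact: le_lt_trans (Dr _ Dy) r'r.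
exact: omega_forward_close stxy Gy.
Qed.

(** Inside a minimal invariant set [Y] carrying stable continua of size [s], the
    limit [L] of avoiding continua has points [y] whose forward orbit stays away
    from [p]; but [L] is in the omega-limit set of [y], which is then a
    competitor of [Y] and must contain [p]. *)
Lemma no_stable_continuum C : ~ stable_continuum T eps s C.
Proof.
move=> stC.
have G_cont : continuous G by exact: iter_continuous.
have H_cont : continuous H by exact: iter_continuous.
have GK : cancel G H by exact: iter_cancel.
pose good Y := [/\ closed Y, forall y, Y y -> Y (G y), forall y, Y y -> Y (H y)
  & exists2 K, stable_continuum T eps s K & K `<=` Y].
(* The maximality lemma is for unions, so the minimal set is the complement of
   a maximal A. *)
have [A [gA minA]] : exists A, good (~` A) /\ forall B, A `<` B -> ~ good (~` B).
  apply: (@Zorn_bigcup X [set A | good (~` A)]) => F Fgood Ftot.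
  split.
  - rewrite setC_bigcup; apply: closed_bigI => A FA.
    by have [] := Fgood _ FA.
  - move=> y nFy [A FA] AGy; apply: nFy; exists A => //.
    by apply: contrapT => nAy; have [_ /(_ _ nAy)] := Fgood _ FA.
  - move=> y nFy [A FA] AGy; apply: nFy; exists A => //.
    by apply: contrapT => nAy; have [_ _ /(_ _ nAy)] := Fgood _ FA.
  - have [F0|/nonemptyPn F0] := pselect (F !=set0); last first.
      (* The empty chain is bounded by the whole space, which contains C. *)
      by exists C => // z _ [A]; rewrite F0.
    have [|||K stK KF] := @limit_stable_continuum _ _ X_compact _ F setC
      T eps s T_cont F0.
    + by move=> A FA; have [] := Fgood _ FA.
    + move=> A B FA FB; have [AB|BA] := Ftot _ _ FA FB.
        by exists B => // z nBz; split=> // /AB.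
      by exists A => // z nAz; split=> // /BA.
    + by move=> A FA; have [] := Fgood _ FA.
    + by exists K => // z Kz [A FA]; exact: KF.
have [clY YG YH [K stK KY]] := gA.
have [p Yp] : exists p, (~` A) p.
  by case: stK => _ _ [[p _] _ [/= /KY Yp _]]; exists p.
have YGn n y : (~` A) y -> (~` A) (iter n G y).
  by move=> Yy; elim: n => [//|n IH]; exact: YG.
have YHn n y : (~` A) y -> (~` A) (iter n H y).
  by move=> Yy; elim: n => [//|n IH]; exact: YH.
pose Z (k : nat) := ~` A `&` [set z | forall i, (i < k)%N -> s <= d p (iter i G z)].
have [||||L stL LZ] := @limit_stable_continuum _ _ X_compact _ setT Z T eps s T_cont.
- by exists 0%N.
- move=> k _; apply: closedI => //; apply: closed_forall => i.
  apply: closed_forall => _; apply: closed_mdist_ge => z; first exact: cvg_cst.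
  exact: iter_continuous.
- move=> i j _ _; exists (maxn i j) => // z [Yz hz].
  by split; split=> // n nij; apply: hz; rewrite leq_max nij ?orbT.
- move=> k _; have [D [stD DK Dp]] := avoiding_continuum p k stK.
  exists D => // z Dz; split; last by move=> i ik; exact: Dp.
  by rewrite -(iter_cancel GK k z); apply: YHn; apply: KY; exact: DK.
have [y Ly] : L !=set0 by case: stL => _ _ [[y _] _ [/= Ly _]]; exists y.
have Yy : (~` A) y by have [] := LZ 0%N I y Ly.
have gW : good (~` (~` omega G y)).
  rewrite setCK; split.
  - exact: omega_closed.
  - by move=> z; exact: omega_image.
  - by move=> z; exact: omega_preimage.
  - by exists L => // z Lz; exact: stable_continuum_sub_omega stL Ly Lz.
have op : omega G y p.
  apply: contrapT => nop; apply: minA gW; split.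
    move=> z Az oz; have : (~` A) z; last exact.
    by apply: omega_sub_closed oz => // n; exact: YGn.
  by move=> /(_ p nop) /Yp.
have [|n _ /=] := op [set z | d p z < s] _ 0%N.
- apply: open_nbhs_nbhs; split; last by rewrite /= mdistxx.
  by apply: open_mdist_lt => z; [exact: cvg_cst|exact: cvg_id].
- have [_ /(_ n (ltnSn n))] := LZ n.+1 I y Ly.
  by rewrite leNgt => /negP.
Qed.

End Power.

(** It only remains to choose the power [N]; the first application of the step
    brings the given continuum to size [s]. *)
Lemma exists_nonrecurrent t C : 0 < t -> stable_continuum T eps t C ->
  exists x, ~ omega T x x /\ ~ omega S x x.
Proof.
move=> t0 stC; apply: contrapT => nx.
have rec x : omega T x x \/ omega S x x.
  by apply: contrapT => /not_orP h; apply: nx; exists x.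
have [s s0 step] := stable_step X_compact TK SK T_cont S_cont eps0 exp_TS.
have [M stepM] := step _ s0.
have [M' stepM'] := step _ t0.
have [x Cx] : C !=set0 by case: stC => _ _ [[x _] _ [/= Cx _]]; exists x.
have [D [stD _ _]] := stepM' M' x C (leqnn M') stC.
have stepN p E := stepM M.+1 p E (leqnSn M).
exact: (no_stable_continuum (ltn0Sn M) s0 stepN step rec stD).
Qed.

End Expansive.

(** * Non-recurrent points of expansive homeomorphisms *)

Lemma positively_recurrent_omega (Y : topologicalType) (f : homeo Y) (x : Y) :
  positively_recurrent f x -> omega f x x.
Proof.
move=> [n_ [_ n_mono cvg]] V Vx N.
have [M _ hM] := cvg V Vx.
have le_n i : (i <= n_ i)%N.
  by elim: i => // i IH; apply: leq_ltn_trans IH _; exact: n_mono.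
exists (n_ (maxn M N)); first by rewrite (leq_trans _ (le_n _))// leq_maxr.
by apply: (hM (maxn M N)); rewrite /= leq_maxl.
Qed.

Definition homeo_inverse (Y : topologicalType) (f : homeo Y) : homeo Y :=
  Homeo (@homeo_invK _ f) (@homeo_funK _ f) (@homeo_inv_continuous _ f)
    (@homeo_fun_continuous _ f).

Lemma iterzN (Y : topologicalType) (f : homeo Y) (n : nat) :
  iterz f (- n%:Z) = iterz (homeo_inverse f) n%:Z.
Proof. by case: n => [|n]; rewrite ?oppr0// -NegzE. Qed.

Lemma negatively_recurrent_omega (Y : topologicalType) (f : homeo Y) (x : Y) :
  negatively_recurrent f x -> omega (homeo_inv f) x x.
Proof.
move=> [n_ [n0 n_mono cvg]].
apply: (@positively_recurrent_omega Y (homeo_inverse f)).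
exists n_; split=> //.
by under eq_fun do rewrite -iterzN.
Qed.

Lemma expansive_forward_close (R : realType) (X : metricType R) (f : homeo X) :
  expansive f -> exists2 eps : R, 0 < eps & forall x y,
    forward_close f eps x y -> forward_close (homeo_inv f) eps x y -> x = y.
Proof.
move=> [c c0 hc]; exists c => // x y xyf xyg; apply: contrapT => /hc.
apply/negP; rewrite -leNgt; apply: ge_ereal_sup => _ [[n|n] _ <-].
  by rewrite lee_fin; exact: xyf.
by rewrite lee_fin; exact: (xyg n.+1).
Qed.

Theorem corollary1p3 (R : realType) (X : metricType R) (f : homeo X)
    (X_nonempty : [set: X] !=set0)
    (X_connected : connected [set: X])
    (X_compact : compact [set: X])
    (f_expansive : expansive f)
    (X_not_single_point : ~ exists x : X, [set: X] = [set x]) :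
  exists x : X, ~ recurrent f x.
Proof.
have [eps eps0 exp_f] := expansive_forward_close f_expansive.
have fK := @homeo_funK _ f; have gK := @homeo_invK _ f.
have f_cont := @homeo_fun_continuous _ f.
have g_cont := @homeo_inv_continuous _ f.
have [x _] := X_nonempty.
have [y xy] : exists y, x <> y.
  apply: contrapT => ny; apply: X_not_single_point; exists x.
  apply/seteqP; split=> // y _; apply: contrapT => yx.
  by apply: ny; exists y => /esym.
have [z [nfz ngz]] : exists z, ~ omega f z z /\ ~ omega (homeo_inv f) z z.
  have [t t0 [[C stC]|[C stC]]] := exists_stable_continuum X_compact fK gK
    f_cont g_cont eps0 exp_f X_connected xy.
    exact: (exists_nonrecurrent X_compact fK gK f_cont g_cont eps0 exp_f t0 stC).
  have exp_g u v : forward_close (homeo_inv f) eps u v ->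
      forward_close f eps u v -> u = v by move=> *; exact: exp_f.
  have [z [? ?]] :=
    exists_nonrecurrent X_compact gK fK g_cont f_cont eps0 exp_g t0 stC.
  by exists z.
by exists z => -[/positively_recurrent_omega|/negatively_recurrent_omega].
Qed.
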